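(* Let $M=p_1^{n_1}M_1$, where $p_1$ is prime, $n_1\in\mathbb{N}$, $M_1\in\mathbb{N}$ and $p_1\nmid M_1$. Assume that for every $M'\mid M_1$ and every tiling $A'\oplus B'=\mathbb{Z}_{M'}$, both $A'$ and $B'$ satisfy (T2). Assume further that $$p_1>D(M_1),\qquad\text{where } D(N):=\frac{N}{\prod_{p\mid N,\ p\text{ prime}}p}.$$ Then for every tiling $A\oplus B=\mathbb{Z}_M$, both $A$ and $B$ satisfy (T2).
   Context: For $N\in\mathbb{N}$ and $A,B\subset\mathbb{Z}_N$, write $A\oplus B=\mathbb{Z}_N$ (a tiling) if every element of $\mathbb{Z}_N$ has a unique representation $a+b$ with $a\in A$, $b\in B$. A subset $A\subset\mathbb{Z}_N$ is identified with a subset of $\{0,1,\dots,N-1\}$, and its mask polynomial is $A(X)=\sum_{a\in A}X^a$. $\Phi_s$ denotes the $s$-th cyclotomic polynomial. Let $S_A$ be the set of prime powers $p^\alpha$ ($\alpha\ge1$) such that $\Phi_{p^\alpha}(X)\mid A(X)$. The set $A$ satisfies (T2) if: whenever $s_1,\dots,s_k\in S_A$ are powers of distinct primes, $\Phi_{s_1s_2\cdots s_k}(X)$ divides $A(X)$. *)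

(* Defs.v *)
From mathcomp Require Import all_boot all_algebra all_field.
Set Implicit Arguments. Unset Strict Implicit. Unset Printing Implicit Defensive.
Import GRing.Theory.
Local Open Scope ring_scope.

Definition tiling (N : nat) (A B : {set 'I_N}) : Prop :=
  forall x : 'I_N,
    #|[set ab : 'I_N * 'I_N | [&& ab.1 \in A, ab.2 \in B &
                                  ((ab.1 + ab.2) %% N)%N == x]]| = 1%N.

Definition mask (N : nat) (A : {set 'I_N}) : {poly rat} :=
  \sum_(a in A) 'X^a.

Definition Phi_dvd (s : nat) (P : {poly rat}) : bool :=
  map_poly (intr : int -> rat) ('Phi_s) %| P.

Definition in_SA (N : nat) (A : {set 'I_N}) (p alpha : nat) : bool :=
  [&& prime p, (0 < alpha)%N & Phi_dvd (p ^ alpha) (mask A)].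

Definition T2 (N : nat) (A : {set 'I_N}) : Prop :=
  forall s : seq (nat * nat),
    s != [::] ->
    uniq (map fst s) ->
    all (fun pa => in_SA A pa.1 pa.2) s ->
    Phi_dvd (\prod_(pa <- s) pa.1 ^ pa.2)%N (mask A).

Definition Dfun (N : nat) : nat := (N %/ \prod_(p <- primes N) p)%N.

(* Main.v *)
(* Induction on the period, which is lowered by one prime factor at a time. Write M = p^n M_1
   with p not dividing M_1, put h = p^(n-1), and let A + B = Z_M with Phi_{p^n} | A (one of A, B
   has this factor). Decompose every z as al(z) + be(z), and choose H = h mod p^n with M_1 | H.

   By Sands' theorem, exactly one of al(z) = al(z+H), be(z) = be(z+H) holds modulo p^n, and the
   choice is constant along the orbit z, z+H, z+2H, ... Let R be the set of z for which the first
   alternative holds; the key point is that R is empty. Fix a class c mod p^n and a root of unity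
   x with x^M_1 = 1. The sum of x^z over the z in R with z = c mod p^n is p times an algebraic
   integer. Indeed, since the primitive p^n-th roots of unity times x are
   conjugate and are all zeros of A or all zeros of B, the partial sums of x^a over the classes a = g mod p^n are
   h-periodic in g for A or for B. In the first case the part of the sum with al(z) = g is
   h-periodic in g; in the second the same argument with A and B exchanged applies to the
   complement of R, and the sum over all z = c vanishes (x = 1 falls in the first case). Fourier
   inversion over Z_{M_1} then makes M_1 times the indicator of R divisible by p, so R is empty.

   Hence be(z) = be(z+H) mod p^n for all z, so each set obtained from A by keeping, for every
   class r mod h, only one of the p classes mod p^n above r, tiles with B modulo M/p. All
   these slabs satisfy (T2) by induction, and so does B; letting the slab vary gives (T2) for A. *)
Require Import Defs.
From mathcomp Require Import all_boot all_order all_algebra all_solvable all_field.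
From mathcomp Require Import zify ring.
Set Implicit Arguments. Unset Strict Implicit. Unset Printing Implicit Defensive.
Import GRing.Theory.
Local Open Scope ring_scope.

(** * Tilings by lists of integers and cyclotomic divisibility *)

(* The elements are not reduced modulo the period: the same [B] is then used with the periods
   [M] and [M/p]. *)
Definition pairs (A B : seq nat) : seq (nat * nat) := [seq (a, b) | a <- A, b <- B].

(** Equality of multisets states existence and uniqueness of representations at once. *)
Definition seq_tiling (N : nat) (A B : seq nat) : bool :=
  perm_eq [seq ((ab.1 + ab.2) %% N)%N | ab <- pairs A B] (iota 0 N).

Definition seq_mask (A : seq nat) : {poly rat} := \sum_(a <- A) 'X^a.

Definition ev (A : seq nat) (z : algC) : algC := \sum_(a <- A) z ^+ a.

(** The last clause says that [(al z, be z)] runs exactly once through the pairs when [z] runs below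
    [N], in the form of a change of summation variable. *)
Definition decomposition (N : nat) (A B : seq nat) (al be : nat -> nat) : Prop :=
  [/\ forall z, al z \in A, forall z, be z \in B,
      forall z, (al z + be z = z %[mod N])%N &
      forall F : nat -> nat -> algC,
        \sum_(a <- A) \sum_(b <- B) F a b = \sum_(z < N) F (al z) (be z)].

Lemma decompositionC N A B al be : decomposition N A B al be -> decomposition N B A be al.
Proof.
case=> alA beB E R; split=> // [z|F]; first by rewrite addnC.
by rewrite exchange_big (R (fun a b => F b a)).
Qed.

Lemma ev1 A : ev A 1 = (size A)%:R.
Proof.
rewrite /ev (eq_bigr (fun=> 1)) => [|a _]; last exact: expr1n.
by rewrite -(natr_sum _ A predT (fun=> 1%N)) sum1_size.
Qed.

Lemma prime_power_gt1 p a : prime p -> (0 < a)%N -> (1 < p ^ a)%N.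
Proof.
by case: a => // a p_pr _; rewrite -[X in (X < _)%N](exp1n a.+1) ltn_exp2r ?prime_gt1.
Qed.

Lemma mem_pairs A B a b : ((a, b) \in pairs A B) = (a \in A) && (b \in B).
Proof.
apply/allpairsP/andP => [[[x y] [/= xA yB [-> ->]]]|[aA bB]] //.
by exists (a, b).
Qed.

Lemma seq_tilingC N A B : seq_tiling N A B -> seq_tiling N B A.
Proof.
apply: perm_trans; apply/permP => P.
rewrite -!sum1_count !big_map big_mkcond [RHS]big_mkcond !big_allpairs exchange_big /=.
by apply: eq_bigr => a _; apply: eq_bigr => b _; rewrite addnC.
Qed.

Lemma prim_root_mul (m n : nat) (x y : algC) :
  m.-primitive_root x -> n.-primitive_root y -> coprime m n ->
  (m * n).-primitive_root (x * y).
Proof.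
move=> px py co; have m0 := prim_order_gt0 px; have n0 := prim_order_gt0 py.
have mn0 : (0 < m * n)%N by rewrite muln_gt0 m0.
have xy1 : (x * y) ^+ (m * n) = 1.
  by rewrite exprMn exprM (prim_expr_order px) mulnC exprM (prim_expr_order py) !expr1n mulr1.
have [k pk kmn] := prim_order_exists mn0 xy1.
suff /eqP <- : k == (m * n)%N by [].
have Ek i : x ^+ (k * i) * y ^+ (k * i) = 1.
  by rewrite -exprMn exprM (prim_expr_order pk) expr1n.
have co' : coprime n m by rewrite coprime_sym.
rewrite eqn_dvd kmn Gauss_dvd //=; apply/andP; split.
  rewrite -(Gauss_dvdl k co) (prim_order_dvd px) -(Ek n).
  by rewrite [y ^+ _](_ : _ = 1) ?mulr1 // mulnC exprM (prim_expr_order py) expr1n.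
rewrite -(Gauss_dvdl k co') (prim_order_dvd py) -(Ek m).
by rewrite [x ^+ _](_ : _ = 1) ?mul1r // mulnC exprM (prim_expr_order px) expr1n.
Qed.

Lemma sum_prim_root (N : nat) (z : algC) k : N.-primitive_root z ->
  \sum_(i < N) z ^+ (i * k) = if (N %| k)%N then N%:R else 0.
Proof.
move=> pz; case: ifPn => dk.
  rewrite (eq_bigr (fun=> 1)) ?sumr_const ?card_ord // => i _.
  by apply/eqP; rewrite -(prim_order_dvd pz) dvdn_mull.
have zk1 : z ^+ k - 1 != 0 by rewrite subr_eq0 -(prim_order_dvd pz).
apply: (mulfI zk1); rewrite mulr0.
under eq_bigr do rewrite mulnC exprM.
by rewrite -subrX1 -exprM mulnC exprM (prim_expr_order pz) expr1n subrr.
Qed.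

Lemma ev_mask A z : (map_poly ratr (seq_mask A)).[z] = ev A z.
Proof.
rewrite /seq_mask rmorph_sum horner_sum; apply: eq_bigr => a _.
by rewrite rmorphXn /= map_polyX hornerXn.
Qed.

(** ['Phi_d] is the minimal polynomial over the rationals of every primitive [d]-th root of unity,
    so a single such root decides divisibility. *)
Lemma Phi_dvdE d A z : d.-primitive_root z -> Phi_dvd d (seq_mask A) = (ev A z == 0).
Proof.
move=> pz; rewrite /Phi_dvd -ev_mask.
have [q [qE _] qP] := minCpolyP z; rewrite -rootE qP.
rewrite (minCpoly_cyclotomic pz) -(Cintr_Cyclotomic pz) in qE.
suff -> : map_poly intr 'Phi_d = q by [].
apply: (map_poly_inj (ratr : {rmorphism rat -> algC})).
rewrite -qE -map_poly_comp; apply: eq_map_poly => i /=.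
by rewrite ratr_int.
Qed.

Lemma Phi_dvdP d A : (0 < d)%N ->
  reflect (forall z, d.-primitive_root z -> ev A z = 0) (Phi_dvd d (seq_mask A)).
Proof.
move=> d0; apply: (iffP idP) => [H z pz|H].
  by apply/eqP; rewrite -(Phi_dvdE _ pz).
by have [z pz] := C_prim_root_exists d0; rewrite (Phi_dvdE _ pz) H.
Qed.

Section Tilings.

Variables (N : nat) (A B : seq nat).
Hypotheses (N0 : (0 < N)%N) (tAB : seq_tiling N A B).

Lemma tiling_size : (size A * size B)%N = N.
Proof. by have := perm_size tAB; rewrite size_map size_iota size_allpairs. Qed.

Lemma tiling_uniq : uniq (pairs A B).
Proof.
by apply: (@map_uniq _ _ (fun ab => (ab.1 + ab.2) %% N)%N); rewrite (perm_uniq tAB) iota_uniq.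
Qed.

Lemma tiling_inj a b a' b' : a \in A -> a' \in A -> b \in B -> b' \in B ->
  (a + b = a' + b' %[mod N])%N -> a = a' /\ b = b'.
Proof.
move=> aA aA' bB bB' E.
have : uniq [seq ((ab.1 + ab.2) %% N)%N | ab <- pairs A B] by rewrite (perm_uniq tAB) iota_uniq.
move=> /(uniqP 0%N); set f := fun ab => _; set s := pairs A B => U.
have iP x y : x \in A -> y \in B -> (index (x, y) s < size s)%N.
  by move=> xA yB; rewrite index_mem mem_pairs xA.
have := U (index (a, b) s) (index (a', b') s).
rewrite !inE !size_map !iP // !(nth_map (0, 0)%N) ?iP // !nth_index ?mem_pairs ?aA ?aA' //.
move=> /(_ isT isT E) /(congr1 (nth (0, 0)%N s)).
by rewrite !nth_index ?mem_pairs ?aA ?aA' // => -[].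
Qed.

Lemma tiling_decomp : exists al be : nat -> nat, decomposition N A B al be.
Proof.
have /all_sig2 [f fm fE] : forall z, {ab | ab \in pairs A B & (ab.1 + ab.2) %% N == z %% N}%N.
  move=> z; apply: sig2W.
  have : (z %% N)%N \in [seq ((ab.1 + ab.2) %% N)%N | ab <- pairs A B].
    by rewrite (perm_mem tAB) mem_iota /= add0n ltn_mod.
  by case/mapP => ab abm ->; exists ab.
have fA z : (f z).1 \in A /\ (f z).2 \in B.
  by have := fm z; case: (f z) => a b; rewrite mem_pairs => /andP.
exists (fun z => (f z).1), (fun z => (f z).2); split=> [z|z|z|F].
- by case: (fA z).
- by case: (fA z).
- exact/eqP.
rewrite -(@big_allpairs _ _ _ _ _ A B (fun ab => F ab.1 ab.2)) -/(pairs A B).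
rewrite (perm_big [seq f z | z <- iota 0 N]) /=; last first.
  apply: uniq_perm => [||[a b]]; first exact: tiling_uniq.
    rewrite map_inj_in_uniq ?iota_uniq // => x y; rewrite !mem_iota /= !add0n => xN yN E.
    by rewrite -(modn_small xN) -(modn_small yN) -(eqP (fE x)) E (eqP (fE y)).
  apply/idP/mapP => [|[z _ ->]]; last exact: fm.
  rewrite mem_pairs => /andP [aA bB]; exists ((a + b) %% N)%N.
    by rewrite mem_iota add0n ltn_mod.
  have [fA1 fB1] := fA ((a + b) %% N)%N.
  have /eqP := fE ((a + b) %% N)%N; rewrite modn_mod => /esym E.
  have [E1 E2] := tiling_inj aA fA1 bB fB1 E.
  by rewrite [RHS]surjective_pairing -E1 -E2.
rewrite big_map -[iota 0 N](_ : index_iota 0 N = _) ?big_mkord //.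
by rewrite /index_iota subn0.
Qed.

Lemma tiling_ev z : z ^+ N = 1 -> z != 1 -> ev A z * ev B z = 0.
Proof.
move=> zN z1; have [al [be [_ _ E R]]] := tiling_decomp.
rewrite /ev big_distrlr R /=.
have -> : \sum_(i < N) z ^+ al i * z ^+ be i = \sum_(i < N) z ^+ i.
  by apply: eq_bigr => i _; rewrite -exprD -(expr_mod _ zN) E expr_mod.
have z10 : z - 1 != 0 by rewrite subr_eq0.
by apply: (mulfI z10); rewrite -subrX1 zN subrr mulr0.
Qed.

Lemma tiling_Phi d : (d %| N)%N -> d != 1%N ->
  Phi_dvd d (seq_mask A) || Phi_dvd d (seq_mask B).
Proof.
move=> dN d1; have d0 := dvdn_gt0 N0 dN.
have [z pz] := C_prim_root_exists d0.
rewrite !(Phi_dvdE _ pz) -mulf_eq0 tiling_ev //.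
  by apply/eqP; rewrite -(prim_order_dvd pz).
by apply: contra d1 => /eqP E; rewrite -dvdn1 (prim_order_dvd pz) E expr1.
Qed.

(* Sands: by Galois conjugation [B] and [t B] have the same zeros among the [N]-th roots of
   unity, so the number of representations [a + t b] of any residue is still [1]. *)
Lemma tiling_dilate t a b a' b' : coprime t N ->
  a \in A -> a' \in A -> b \in B -> b' \in B ->
  (a + t * b = a' + t * b' %[mod N])%N -> a = a' /\ b = b'.
Proof.
move=> co aA aA' bB bB' E.
have [z pz] := C_prim_root_exists N0.
have zN := prim_expr_order pz.
(* [N.-1] stands for [-1]: [P] says [ab.1 + t * ab.2 = a + t * b] modulo [N]. The number of such
   pairs is expanded into characters, of which only the trivial one contributes. *)
pose P (ab : nat * nat) := (N %| ab.1 + t * ab.2 + N.-1 * (a + t * b))%N.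
have Pab : P (a, b) by rewrite /P /= -mulSn prednK // dvdn_mulr.
have Pab' : P (a', b').
  rewrite /P /= /dvdn -modnDml -E modnDml -/(dvdn _ _); exact: Pab.
suff c1 : count P (pairs A B) = 1%N.
  have := c1; rewrite -size_filter.
  have : (a, b) \in filter P (pairs A B) by rewrite mem_filter Pab mem_pairs aA.
  have : (a', b') \in filter P (pairs A B) by rewrite mem_filter Pab' mem_pairs aA'.
  by case: filter => [|x [|]] //=; rewrite !inE => /eqP <- /eqP [-> ->].
have N0' : N%:R != 0 :> algC by rewrite Num.Theory.pnatr_eq0 -lt0n.
apply/eqP; rewrite -(@Num.Theory.eqr_nat algC); apply/eqP/(mulfI N0'); rewrite mulr1.
rewrite -sum1_count natr_sum big_mkcond /= mulr_sumr.
have -> : \sum_(i <- pairs A B) N%:R * (if P i then 1%:R else 0) =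
   \sum_(i <- pairs A B) \sum_(k < N) z ^+ (k * (i.1 + t * i.2 + N.-1 * (a + t * b))) :> algC.
  by apply: eq_bigr => i _; rewrite (sum_prim_root _ pz) -/(P i); case: ifP; rewrite ?mulr1 ?mulr0.
rewrite exchange_big /=.
have -> : \sum_(k < N) \sum_(i <- pairs A B) z ^+ (k * (i.1 + t * i.2 + N.-1 * (a + t * b))) =
  \sum_(k < N) ev A (z ^+ k) * ev B (z ^+ (k * t)) * z ^+ (k * (N.-1 * (a + t * b))).
  apply: eq_bigr => k _; rewrite big_allpairs /ev big_distrlr /= mulr_suml.
  apply: eq_bigr => x _; rewrite mulr_suml; apply: eq_bigr => y _.
  by rewrite -!exprM -!exprD !mulnDr !mulnA.
case: N N0 zN pz tiling_ev tiling_size co => // n _ zN pz tev tsz co.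
rewrite big_ord_recl big1 ?addr0.
  by rewrite !mul0n !expr0 mulr1 !ev1 -natrM tsz.
move=> i _; set k := lift _ _.
(* Since [t] is prime to [N], [z ^+ k] and [z ^+ (k * t)] have the same order, so [ev B] vanishes at
   both or at neither. *)
have pk := exp_prim_root pz k.
have pkt : (n.+1 %/ gcdn k n.+1).-primitive_root (z ^+ (k * t)).
  by have := exp_prim_root pz (k * t); rewrite gcdnC Gauss_gcdl ?[gcdn _ k]gcdnC // coprime_sym.
have := tev (z ^+ k); rewrite -exprM mulnC exprM zN expr1n => /(_ erefl).
rewrite -(expr1 (z ^+ k)) -(prim_order_dvd pk) dvdn1.
have -> : (n.+1 %/ gcdn k n.+1 == 1)%N = false.
  apply/negbTE/negP => /eqP E1.
  have /divnK : (gcdn k n.+1 %| n.+1)%N by exact: dvdn_gcdr.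
  rewrite E1 mul1n => E2; have := dvdn_gcdl k n.+1; rewrite E2 => /dvdn_leq.
  by have := ltn_ord i; rewrite /k lift0; lia.
rewrite expr1 => /(_ isT) /eqP; rewrite mulf_eq0 -(Phi_dvdE B pk) (Phi_dvdE B pkt).
by case/orP => /eqP ->; rewrite ?mul0r ?mulr0 ?mul0r.
Qed.

End Tilings.

(** * Residue classes modulo a prime power *)

Lemma sum_shift N (F : nat -> algC) k : (forall z, F (z + N)%N = F z) ->
  \sum_(z < N) F (z + k)%N = \sum_(z < N) F z.
Proof.
move=> per; elim: k => [|k IH]; first by apply: eq_bigr => z _; rewrite addn0.
rewrite -IH; case: N per {IH} => [|N] per; first by rewrite !big_ord0.
rewrite big_ord_recr [RHS]big_ord_recl /= addrC; congr (_ + _).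
  by rewrite -[RHS]per; congr F; lia.
by apply: eq_bigr => i _; rewrite /bump /= add1n addSn addnS.
Qed.

(** Read from right to left, it inserts a sum over classes; exchanging the summations then sorts a
    sum by residues modulo [q]. *)
Lemma sum_class (V : Type) (idx : V) (op : Monoid.com_law idx) q x (c : V) : (0 < q)%N ->
  \big[op/idx]_(g < q) (if (x == g %[mod q])%N then c else idx) = c.
Proof.
move=> q0; have xq : (x %% q < q)%N by rewrite ltn_mod.
rewrite (bigD1 (Ordinal xq)) //= modn_mod eqxx big1 ?Monoid.mulm1 // => g neq.
case: ifP => // /eqP E; case/eqP: neq; apply: val_inj => /=.
by rewrite E modn_small.
Qed.

Definition evc (A : seq nat) q g (z : algC) : algC :=
  \sum_(a <- A | (a == g %[mod q])%N) z ^+ a.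

Lemma evcE A q g z :
  evc A q g z = \sum_(a <- A) (if (a == g %[mod q])%N then z ^+ a else 0).
Proof. by rewrite /evc big_mkcond. Qed.

Section PrimePower.

Variables (p n : nat).
Hypotheses (p_pr : prime p) (n0 : (0 < n)%N).
Let q := (p ^ n)%N.
Let h := (p ^ n.-1)%N.

Let qE : q = (p * h)%N. Proof. by rewrite /q /h -expnS prednK. Qed.
Let p0 : (0 < p)%N. Proof. exact: prime_gt0. Qed.
Let q0 : (0 < q)%N. Proof. by rewrite expn_gt0 p0. Qed.
Let h0 : (0 < h)%N. Proof. by rewrite expn_gt0 p0. Qed.

(* Fourier inversion on [Z_q]: only the non-primitive [q]-th roots of unity contribute to the
   class sum, and their [h]-th power is [1]. *)
Lemma evc_shift A x : (forall w, q.-primitive_root w -> ev A (w * x) = 0) ->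
  forall g, evc A q (g + h) x = evc A q g x.
Proof.
move=> A0 g; have [w pw] := C_prim_root_exists q0.
have q0' : q%:R != 0 :> algC by rewrite Num.Theory.pnatr_eq0 -lt0n.
have inv k : q%:R * evc A q k x = \sum_(i < q) w ^+ (i * (q.-1 * k)) * ev A (w ^+ i * x).
  rewrite evcE mulr_sumr.
  transitivity (\sum_(a <- A) \sum_(i < q) x ^+ a * w ^+ (i * (a + q.-1 * k))).
    apply: eq_bigr => a _; rewrite -mulr_sumr (sum_prim_root _ pw).
    have -> : (q %| a + q.-1 * k)%N = (a == k %[mod q])%N.
      rewrite -[RHS](eqn_modDr (q.-1 * k)) -mulSn prednK // modnMr.
      by rewrite /dvdn.
    by case: ifP => _; rewrite ?mulr0 // mulrC.
  rewrite exchange_big; apply: eq_bigr => i _; rewrite mulr_sumr.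
  apply: eq_bigr => a _; rewrite exprMn -exprM mulnDr exprD; ring.
apply: (mulfI q0'); rewrite !inv; apply: eq_bigr => i _.
have [pi|pi] := boolP (p %| i)%N.
  congr (_ * _); rewrite !mulnDr exprD.
  suff /eqP -> : w ^+ (i * (q.-1 * h)) == 1 by rewrite mulr1.
  rewrite -(prim_order_dvd pw).
  by case/dvdnP: pi => k ->; rewrite qE; apply/dvdnP; exists (k * (p * h).-1)%N; ring.
rewrite A0 ?mulr0 //; have := exp_prim_root pw i.
rewrite [gcdn _ _](_ : _ = 1%N) ?divn1 //.
by apply/eqP; rewrite -/(coprime _ _) /q coprime_pexpr // coprime_sym prime_coprime.
Qed.

(** Sorted by classes, the sum is invariant under [g -> g + h], yet this shift multiplies it by
    [w ^+ h], which is not [1]. This is the converse of [evc_shift]. *)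
Lemma ev_shift A x w : (forall g, evc A q (g + h) x = evc A q g x) ->
  q.-primitive_root w -> ev A (w * x) = 0.
Proof.
move=> inv pw.
have S : ev A (w * x) = \sum_(g < q) w ^+ g * evc A q g x.
  under [RHS]eq_bigr do rewrite evcE mulr_sumr.
  rewrite exchange_big; apply: eq_bigr => a _ /=.
  rewrite -[LHS](@sum_class _ 0 +%R q a _ q0); apply: eq_bigr => g _.
  case: ifP => [/eqP E|_]; last by rewrite mulr0.
  by rewrite exprMn -(expr_mod a (prim_expr_order pw)) E (expr_mod _ (prim_expr_order pw)).
have wh : w ^+ h - 1 != 0.
  rewrite subr_eq0 -(prim_order_dvd pw) qE; apply/negP => /dvdn_leq.
  by rewrite h0 => /(_ isT); rewrite leqNgt ltn_Pmull // prime_gt1.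
apply: (mulfI wh); rewrite mulr0 mulrBl mul1r; apply/eqP; rewrite subr_eq0; apply/eqP.
rewrite S mulr_sumr -[RHS](sum_shift (F := fun g => w ^+ g * evc A q g x) h).
  by apply: eq_bigr => g _; rewrite inv exprD; ring.
move=> g; rewrite exprD (prim_expr_order pw) mulr1 /evc.
by congr (_ * _); apply: eq_bigl => a; rewrite modnDr.
Qed.

Lemma sum_periodic (F : nat -> algC) : (forall g, F (g + h)%N = F g) ->
  \sum_(g < q) F g = p%:R * \sum_(g < h) F g.
Proof.
move=> per; rewrite qE; elim: p => [|k IH]; first by rewrite mul0n big_ord0 mul0r.
have perk i g : F (i * h + g)%N = F g.
  by elim: i g => [|i IHi] g; rewrite ?mul0n // mulSn -addnA addnC per.
rewrite mulSn addnC big_split_ord /= IH -natr1 mulrDl mul1r; congr (_ + _).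
by apply: eq_bigr => i _; rewrite perk.
Qed.

(** Congruent modulo [p ^ n.-1] and not divisible by [p ^ n], [x] and [y] have the same [p]-adic
    valuation; [t] is the quotient of their parts prime to [p]. *)
Lemma unit_quotient x y : (x = y %[mod h])%N -> ~~ (q %| x)%N -> ~~ (q %| y)%N ->
  exists2 t, coprime t q & (t * y = x %[mod q])%N.
Proof.
move=> E qx qy.
have pos z : ~~ (q %| z)%N -> (0 < z)%N by case: z => //; rewrite dvdn0.
have [x0 cx xE] := pfactor_coprime p_pr (pos _ qx).
have [y0 cy yE] := pfactor_coprime p_pr (pos _ qy).
have lx : (logn p x <= n.-1)%N.
  have := qx; rewrite /q pfactor_dvdn ?pos // -ltnNge; lia.
have ly : (logn p y <= n.-1)%N.
  have := qy; rewrite /q pfactor_dvdn ?pos // -ltnNge; lia.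
have dE k : (k <= n.-1)%N -> (p ^ k %| x)%N = (p ^ k %| y)%N.
  by move=> kn; rewrite /dvdn -(modn_dvdm x (dvdn_exp2l p kn)) -(modn_dvdm y (dvdn_exp2l p kn)) E.
have lE : logn p x = logn p y.
  have x0' := pos _ qx; have y0' := pos _ qy.
  apply/eqP; rewrite eqn_leq -(pfactor_dvdn _ p_pr y0') -(pfactor_dvdn _ p_pr x0').
  by rewrite -(dE _ lx) (dE _ ly) !pfactor_dvdn // !leqnn.
have cx' : coprime x0 q by rewrite /q coprime_pexpr // coprime_sym.
have cy' : coprime y0 q by rewrite /q coprime_pexpr // coprime_sym.
exists (x0 * y0 ^ (totient q).-1)%N.
  by rewrite coprimeMl cx' /= coprimeXl.
have -> : (x0 * y0 ^ (totient q).-1 * y = x * y0 ^ totient q)%N.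
  rewrite {1}yE {1}xE lE -{2}(prednK (_ : 0 < totient q)%N) ?totient_gt0 // expnS; ring.
by rewrite -modnMmr (Euler_exp_totient cy') modnMmr muln1.
Qed.

Variables (M1 : nat) (A B : seq nat).
Hypothesis (pM1 : ~~ (p %| M1)%N).
Let M := (q * M1)%N.
Hypothesis tAB : seq_tiling M A B.

Let M10 : (0 < M1)%N. Proof. by case: M1 pM1 => //; rewrite dvdn0. Qed.
Let M0 : (0 < M)%N. Proof. by rewrite muln_gt0 q0. Qed.
Let coM1 : coprime M1 q. Proof. by rewrite /q coprime_pexpr // coprime_sym prime_coprime. Qed.

(* If neither congruence held, [a - a'] and [b' - b] would differ by a unit [T = 1 mod M1]. *)
Lemma split_mod a b a' b' : a \in A -> a' \in A -> b \in B -> b' \in B ->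
  (a + b = a' + b' %[mod h * M1])%N -> (a == a' %[mod q])%N || (b == b' %[mod q])%N.
Proof.
move=> aA aA' bB bB' E; apply: contraT; rewrite negb_or => /andP [na nb].
(* [x] and [y] stand for [a - a'] and [b' - b] modulo [M]. *)
pose x := (a + M.-1 * a')%N; pose y := (b' + M.-1 * b)%N.
have dM : (h * M1 %| M)%N by rewrite /M qE -mulnA dvdn_mull.
have qM : (q %| M)%N by rewrite dvdn_mulr.
have dE d u v : (d %| M)%N -> (d %| u + M.-1 * v)%N = (u == v %[mod d])%N.
  move=> dd; rewrite -[RHS](eqn_modDr (M.-1 * v)) -mulSn prednK //.
  by rewrite [(M * v %% d)%N](eqP (dvdn_mulr _ dd)).
have xy : (x = y %[mod h * M1])%N.
  apply/eqP; rewrite -(eqn_modDr (a' + b)).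
  have -> : (x + (a' + b) = a + b + M * a')%N.
    rewrite /x -{2}(prednK M0) mulSn; ring.
  have -> : (y + (a' + b) = a' + b' + M * b)%N.
    rewrite /y -{2}(prednK M0) mulSn; ring.
  rewrite -modnDmr (eqP (dvdn_mulr _ dM)) addn0 E.
  by rewrite -[X in _ == X]modnDmr (eqP (dvdn_mulr _ dM)) addn0.
have [t ct tE] : exists2 t, coprime t q & (t * y = x %[mod q])%N.
  apply: unit_quotient; rewrite ?dE // 1?eq_sym //.
  by rewrite -(modn_dvdm x (dvdn_mulr M1 (dvdnn h))) xy modn_dvdm ?dvdn_mulr.
pose T := chinese M1 q 1 t.
have T1 : (T = 1 %[mod M1])%N by exact: chinese_modl.
have Tt : (T = t %[mod q])%N by exact: chinese_modr.
have cT : coprime T M.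
  rewrite coprimeMr -coprime_modl Tt coprime_modl ct /=.
  by rewrite -coprime_modl T1 coprime_modl coprime1n.
have TE : (T * y = x %[mod M])%N.
  apply/eqP; rewrite chinese_remainder 1?coprime_sym //; apply/andP; split; apply/eqP.
    by rewrite -modnMml Tt modnMml.
  rewrite -modnMml T1 modnMml mul1n.
  by rewrite -(modn_dvdm y (dvdn_mull h (dvdnn M1))) -xy modn_dvdm ?dvdn_mull.
(* This is [a - a' = T * (b' - b)] rearranged; as [T] is a unit modulo [M], [tiling_dilate] yields
   [a = a'], a contradiction. *)
have : (a + T * b = a' + T * b' %[mod M])%N.
  apply/eqP; rewrite eq_sym -(eqn_modDr (T * M.-1 * b)).
  have -> : (a' + T * b' + T * M.-1 * b = T * y + a')%N by rewrite /y; ring.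
  rewrite -modnDml TE modnDml.
  have -> : (x + a' = a + M * a')%N by rewrite /x -{2}(prednK M0) mulSn; ring.
  have -> : (a + T * b + T * M.-1 * b = a + M * (T * b))%N.
    rewrite -{2}(prednK M0) mulSn; ring.
  by rewrite !(mulnC M) !(addnC a) !modnMDl.
move=> /(tiling_dilate M0 tAB cT aA aA' bB bB') [aa _].
by rewrite aa eqxx in na.
Qed.

End PrimePower.

Lemma Phi_evc_shift p n A g : prime p -> (0 < n)%N -> Phi_dvd (p ^ n) (seq_mask A) ->
  evc A (p ^ n) (g + p ^ n.-1) 1 = evc A (p ^ n) g 1.
Proof.
move=> p_pr n0 PhiA; have q0 : (0 < p ^ n)%N by rewrite expn_gt0 prime_gt0.
by apply: evc_shift => // w pw; rewrite mulr1; apply: (elimT (Phi_dvdP A q0)).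
Qed.

(** * Splitting of the fibers *)

Section Parity.

Variables (p n M1 : nat) (A B : seq nat) (al be : nat -> nat) (H : nat).
Hypotheses (p_pr : prime p) (n0 : (0 < n)%N) (pM1 : ~~ (p %| M1)%N).
Let q := (p ^ n)%N.
Let h := (p ^ n.-1)%N.
Let M := (q * M1)%N.
Hypotheses (tAB : seq_tiling M A B) (dAB : decomposition M A B al be).
Hypotheses (dH : (h * M1 %| H)%N) (Hq : (H = h %[mod q])%N).

Let qE : q = (p * h)%N. Proof. by rewrite /q /h -expnS prednK. Qed.
Let p0 : (0 < p)%N. Proof. exact: prime_gt0. Qed.
Let q0 : (0 < q)%N. Proof. by rewrite expn_gt0 p0. Qed.
Let h0 : (0 < h)%N. Proof. by rewrite expn_gt0 p0. Qed.
Let M10 : (0 < M1)%N. Proof. by case: M1 pM1 => //; rewrite dvdn0. Qed.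
Let M0 : (0 < M)%N. Proof. by rewrite muln_gt0 q0. Qed.
Let qM : (q %| M)%N. Proof. by rewrite dvdn_mulr. Qed.
Let hM : (h * M1 %| M)%N. Proof. by rewrite /M qE -mulnA dvdn_mull. Qed.

(** Membership of [z] in the set R that has to be shown empty. *)
Definition parity z := (al z == al (z + H) %[mod p ^ n])%N.
Local Notation w := parity.

Let alA z : al z \in A. Proof. by case: dAB. Qed.
Let beB z : be z \in B. Proof. by case: dAB. Qed.
Let albe z : (al z + be z = z %[mod M])%N. Proof. by case: dAB. Qed.

Let albeq z : (al z + be z = z %[mod q])%N.
Proof. by rewrite -(modn_dvdm _ qM) albe modn_dvdm. Qed.

Lemma decomp_mod z : al (z %% M) = al z /\ be (z %% M) = be z.
Proof. by apply: (tiling_inj tAB) => //; rewrite !albe modn_mod. Qed.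

Let al_per z : al (z + M) = al z.
Proof. by rewrite -(decomp_mod (z + M)).1 modnDr (decomp_mod z).1. Qed.

Let hq : (h < q)%N. Proof. by rewrite qE ltn_Pmull // prime_gt1. Qed.

Let Hq0 z : (z + H == z %[mod q])%N = false.
Proof.
rewrite -[X in (_ == X %[mod _])%N]addn0 eqn_modDl Hq modn_small // mod0n.
by apply/negbTE; rewrite -lt0n.
Qed.

Let split z z' : (z = z' %[mod h * M1])%N ->
  (al z == al z' %[mod q])%N || (be z == be z' %[mod q])%N.
Proof.
move=> E; apply: (split_mod p_pr n0 pM1 tAB) => //.
by rewrite -(modn_dvdm _ hM) albe modn_dvdm // E -[RHS](modn_dvdm _ hM) albe modn_dvdm.
Qed.

Let splitH z : (al z == al (z + H) %[mod q])%N || (be z == be (z + H) %[mod q])%N.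
Proof. by apply: split; rewrite -modnDmr (eqP dH) addn0. Qed.

(** Otherwise [z] and [z + H] would be congruent modulo [q], while [H = h] is not [0] there. *)
Let not_both z : w z -> (be z == be (z + H) %[mod q])%N -> False.
Proof.
rewrite /w -/q => /eqP ea /eqP eb; have := Hq0 z.
by rewrite -albeq -modnDm -ea -eb modnDm albeq eqxx.
Qed.

Lemma parityN z : ~~ w z = (be z == be (z + H) %[mod p ^ n])%N.
Proof.
apply/idP/idP => [nw|eb]; first by have := splitH z; rewrite -[X in X || _]/(w z) (negbTE nw).
by apply/negP => /not_both; apply.
Qed.

Lemma parity_shift z : w (z + H) = w z.
Proof.
(* If the steps from [z] to [z + H] and on to [z + 2H] were of different kinds, both [al] and [be]
   would change modulo [q] between [z] and [z + 2H]. *)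
have sp2 : (al z == al (z + H + H) %[mod q])%N || (be z == be (z + H + H) %[mod q])%N.
  by apply: split; rewrite -modnDmr (eqP dH) addn0 -modnDmr (eqP dH) addn0.
apply/idP/idP => wz; apply: contraT; rewrite parityN -/q => nb; exfalso.
  case/orP: sp2 => [sa|sb]; last first.
    by apply: (not_both wz); rewrite -(eqP nb).
  move: wz; rewrite /w -/q -(eqP sa) eq_sym => /(not_both (z := z)); exact.
case/orP: sp2 => [sa|sb]; last first.
  by apply: (not_both wz); rewrite (eqP nb).
move: wz; rewrite /w -/q (eqP sa) => wz; apply: (@not_both (z + H)) => //.
by rewrite /w -/q eq_sym.
Qed.

Let parity_per z : w (z + M) = w z.
Proof. by rewrite /w addnAC !al_per. Qed.

Lemma parity_mod z : w (z %% M) = w z.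
Proof.
rewrite /w (decomp_mod z).1 -(decomp_mod (z %% M + H)).1 modnDml.
by rewrite (decomp_mod (z + H)).1.
Qed.

Let HM : (M1 %| H)%N. Proof. exact: dvdn_trans (dvdn_mull h (dvdnn M1)) dH. Qed.

Section Eta.

Variable x : algC.
Hypothesis xM1 : x ^+ M1 = 1.

Let xH : x ^+ H = 1. Proof. by case/dvdnP: HM => k ->; rewrite mulnC exprM xM1 expr1n. Qed.
Let xM : x ^+ M = 1. Proof. by rewrite /M mulnC exprM xM1 expr1n. Qed.

(* Shifting by [H] fixes the class of [al] on the support of [v], and that of [be] on the
   support of [u]. *)
Let v g c : algC :=
  \sum_(z < M | [&& w z, al z == g %[mod q] & z == c %[mod q]]%N) x ^+ z.
Let u g c : algC :=
  \sum_(z < M | [&& ~~ w z, al z == g %[mod q] & z == c %[mod q]]%N) x ^+ z.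

Let shiftP (P Q : pred nat) : (forall z, P (z + M)%N = P z) -> (forall z, P (z + H)%N = Q z) ->
  \sum_(z < M | P z) x ^+ z = \sum_(z < M | Q z) x ^+ z.
Proof.
move=> PM PH; rewrite big_mkcond [RHS]big_mkcond /=.
rewrite -(sum_shift (F := fun z => if P z then x ^+ z else 0) H) => [|z].
  by apply: eq_bigr => z _; rewrite PH exprD xH mulr1.
by rewrite PM exprD xM mulr1.
Qed.

Let shiftc z c : (z + H == c + h %[mod q])%N = (z == c %[mod q])%N.
Proof. by rewrite -modnDmr Hq modnDmr eqn_modDr. Qed.

Let addM z : (z + M = z %[mod q])%N.
Proof. by rewrite -modnDmr (eqP qM) addn0. Qed.

Let vH g c : v g (c + h) = v g c.
Proof.
apply: (@shiftP (fun z => [&& w z, al z == g %[mod q] & z == c + h %[mod q]]%N)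
                (fun z => [&& w z, al z == g %[mod q] & z == c %[mod q]]%N)) => z.
  by rewrite parity_per al_per addM.
rewrite parity_shift shiftc; case: (boolP (w z)) => //= wz.
by move: wz; rewrite /w -/q => /eqP ->.
Qed.

Let uH g c : u (g + h) (c + h) = u g c.
Proof.
apply: (@shiftP (fun z => [&& ~~ w z, al z == g + h %[mod q] & z == c + h %[mod q]]%N)
                (fun z => [&& ~~ w z, al z == g %[mod q] & z == c %[mod q]]%N)) => z.
  by rewrite parity_per al_per addM.
rewrite parity_shift shiftc; case: (boolP (w z)) => //= wz.
move: wz; rewrite parityN -/q => /eqP eb; congr (_ && _).
have ea : (al (z + H) = al z + h %[mod q])%N.
  apply/eqP; rewrite -(eqn_modDr (be (z + H))) albeq.
  have e : (al z + be (z + H) = z %[mod q])%N by rewrite -modnDmr -eb modnDmr albeq.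
  by rewrite [(al z + h + _)%N]addnAC -[X in _ == X]modnDml e modnDml -modnDmr Hq modnDmr.
by rewrite ea eqn_modDr.
Qed.

(** The sum over the class [c - g] of [B], written without subtraction. *)
Let evB g c : algC := \sum_(b <- B | (g + b == c %[mod q])%N) x ^+ b.

Let vu g c : v g c + u g c = evc A q g x * evB g c.
Proof.
rewrite /v /u evcE /evB [X in _ * X]big_mkcond big_distrlr /=.
case: dAB => _ _ _ ->; rewrite big_mkcond [X in _ + X]big_mkcond -big_split /=.
apply: eq_bigr => z _.
have -> : x ^+ z = x ^+ al z * x ^+ be z.
  by rewrite -exprD -(expr_mod (al z + be z) xM) albe (expr_mod _ xM).
have [ea|] := boolP (al z == g %[mod q])%N; last by rewrite !andbF mul0r addr0.
have -> : (g + be z == c %[mod q])%N = (z == c %[mod q])%N.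
  by rewrite -modnDml -(eqP ea) modnDml albeq.
by case: (w z); case: (_ == c %[mod q])%N; rewrite /= ?addr0 ?add0r ?mulr0.
Qed.

Let evBH g c : evB (g + h) (c + h) = evB g c.
Proof. by apply: eq_bigl => b; rewrite addnAC eqn_modDr. Qed.

(** When [g] and [c] both move by [h], the product in [vu] and [u] are unchanged, hence so is [v].
    As [v] is also unchanged when [c] moves alone, it is [h]-periodic in [g], and its sum over
    [g < q] is [p] times the sum over [g < h]. *)
Lemma parity_sum : (forall g, evc A q (g + h) x = evc A q g x) ->
  forall c, exists2 y, y \in Aint & \sum_(z < M | w z && (z == c %[mod q])%N) x ^+ z = p%:R * y.
Proof.
move=> inv c; have vg g : v (g + h) c = v g c.
  rewrite -(vH (g + h)); apply: (addIr (u (g + h) (c + h))).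
  by rewrite vu inv evBH uH vu.
exists (\sum_(g < h) v g c).
  apply: rpred_sum => g _; apply: rpred_sum => z _; apply: rpredX.
  by apply: (Aint_unity_root M10); apply/unity_rootP.
rewrite -(sum_periodic n0 (F := fun g => v g c)) //.
under [RHS]eq_bigr do rewrite /v big_mkcond.
rewrite exchange_big big_mkcond; apply: eq_bigr => z _ /=.
rewrite -[LHS](@sum_class _ 0 +%R q (al z) _ q0); apply: eq_bigr => g _.
by case: (w z); case: (_ == g %[mod q])%N; case: (_ == c %[mod q])%N.
Qed.

End Eta.

End Parity.

(** * Slabs *)

(** The leading base-[p] digit of [a] modulo [p ^ n]. *)
Definition digit p n a := ((a %/ p ^ n.-1) %% p)%N.

Definition slab p n (J : nat -> nat) (A : seq nat) : seq nat :=
  [seq a <- A | digit p n a == J (a %% p ^ n.-1)%N].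

Section Slabs.

Variables (p n : nat).
Hypotheses (p_pr : prime p) (n0 : (0 < n)%N).
Let q := (p ^ n)%N.
Let h := (p ^ n.-1)%N.

Let qE : q = (p * h)%N. Proof. by rewrite /q /h -expnS prednK. Qed.
Let p0 : (0 < p)%N. Proof. exact: prime_gt0. Qed.
Let q0 : (0 < q)%N. Proof. by rewrite expn_gt0 p0. Qed.
Let h0 : (0 < h)%N. Proof. by rewrite expn_gt0 p0. Qed.

Let combine r j : (r < h)%N -> (j < p)%N -> ((r + j * h) %% q = r + j * h)%N.
Proof.
move=> rh jp; rewrite modn_small // qE.
by apply: (@leq_trans (j.+1 * h)); rewrite ?leq_mul2r ?jp ?orbT // mulSn ltn_add2r.
Qed.

Lemma digit_mod a : (a %% q = a %% h + digit p n a * h)%N.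
Proof.
rewrite -(combine (r := a %% h) (j := digit p n a)) ?ltn_mod //.
rewrite {1}(divn_eq a h) {1}(divn_eq (a %/ h) p) mulnDl -mulnA -qE -addnA modnMDl.
by rewrite addnC.
Qed.

Lemma eq_digit a r j : (r < h)%N -> (j < p)%N ->
  (a == r + j * h %[mod q])%N = (a == r %[mod h])%N && (digit p n a == j).
Proof.
move=> rh jp; rewrite combine // digit_mod (modn_small rh).
apply/eqP/andP => [E|[/eqP -> /eqP -> //]]; split; apply/eqP.
  by have := congr1 (modn^~ h) E; rewrite ![(_ + _ * h)%N]addnC !modnMDl modn_mod (modn_small rh).
have := congr1 (divn^~ h) E; rewrite ![(_ + _ * h)%N]addnC !divnMDl //.
by rewrite !(@divn_small _ h) ?ltn_mod // !addn0.
Qed.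

Lemma ev_slab J A x : (forall r, J r < p)%N ->
  ev (slab p n J A) x = \sum_(r < h) evc A q (r + J r * h) x.
Proof.
move=> Jp; rewrite /ev /slab big_filter big_mkcond.
under [RHS]eq_bigr do rewrite evcE.
rewrite exchange_big; apply: eq_bigr => a _ /=.
rewrite -[LHS](@sum_class _ 0 +%R h a _ h0); apply: eq_bigr => r _.
rewrite (@eq_digit a r (J r)) //; case: ifP => //= /eqP ->.
by rewrite (modn_small (ltn_ord r)).
Qed.

Lemma evc_mod A g x : evc A q (g %% q)%N x = evc A q g x.
Proof. by apply: eq_bigl => a; rewrite modn_mod. Qed.

Lemma ev_evc A x : ev A x = \sum_(g < q) evc A q g x.
Proof.
under [RHS]eq_bigr do rewrite evcE.
rewrite exchange_big; apply: eq_bigr => a _ /=.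
by rewrite -[LHS](@sum_class _ 0 +%R q a _ q0).
Qed.

Lemma ev_slabs A x : ev A x = \sum_(j < p) ev (slab p n (fun=> j : nat) A) x.
Proof.
rewrite /ev; under [RHS]eq_bigr do rewrite /slab big_filter big_mkcond.
rewrite exchange_big; apply: eq_bigr => a _ /=.
rewrite -[LHS](@sum_class _ 0 +%R p (digit p n a) _ p0); apply: eq_bigr => j _.
by rewrite (modn_small (ltn_ord j)) /digit modn_mod.
Qed.

(** Changing [J] at one residue [r] replaces a single class sum and keeps the others, so if all
    slabs vanish at [x], the [p] class sums above [r] are equal. *)
Lemma slab_evc A x : (forall J, (forall r, J r < p)%N -> ev (slab p n J A) x = 0) ->
  forall g, evc A q (g + h) x = evc A q g x.
Proof.
move=> S g; rewrite -evc_mod -[RHS]evc_mod !digit_mod modnDr.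
set r := (g %% h)%N; have rh : (r < h)%N by rewrite ltn_mod.
have ev0 j : (j < p)%N -> evc A q (r + j * h) x =
   - \sum_(i < h | i != Ordinal rh) evc A q i x.
  move=> jp; have := S (fun k => if k == r then j else 0%N).
  rewrite ev_slab => [|k]; last by case: ifP.
  rewrite (bigD1 (Ordinal rh)) //= eqxx => E; apply/eqP; rewrite -addr_eq0; apply/eqP.
  rewrite -[RHS]E => [|k]; last by case: ifP.
  congr (_ + _); apply: eq_bigr => i; rewrite -val_eqE /= => /negbTE ->.
  by rewrite mul0n addn0.
by rewrite !ev0 // ltn_mod.
Qed.

Lemma size_slab A J : (forall g, evc A q (g + h) 1 = evc A q g 1) ->
  (forall r, J r < p)%N -> size A = (p * size (slab p n J A))%N.
Proof.
move=> inv Jp; apply/eqP; rewrite -(@Num.Theory.eqr_nat algC) natrM -!ev1.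
rewrite ev_evc (sum_periodic n0 (F := fun g => evc A q g 1)) // ev_slab //.
apply/eqP; congr (_ * _); apply: eq_bigr => r _.
by elim: (J r) => [|j IH]; rewrite ?addn0 // mulSn [(h + _)%N]addnC addnA inv.
Qed.

End Slabs.

Lemma pairs_filter P A B : pairs (filter P A) B = [seq ab <- pairs A B | P ab.1].
Proof.
rewrite /pairs; elim: A => //= a A IH; rewrite filter_cat -IH filter_map /preim /=.
by case: (P a); rewrite ?filter_predT ?filter_pred0.
Qed.

(** * Emptiness of R, and the tilings by slabs *)

Section Uniform.

Variables (p n M1 : nat) (A B : seq nat).
Hypotheses (p_pr : prime p) (n0 : (0 < n)%N) (pM1 : ~~ (p %| M1)%N).
Let q := (p ^ n)%N.
Let h := (p ^ n.-1)%N.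
Let M := (q * M1)%N.
Hypotheses (tAB : seq_tiling M A B) (PhiA : Phi_dvd q (seq_mask A)).

Let qE : q = (p * h)%N. Proof. by rewrite /q /h -expnS prednK. Qed.
Let p0 : (0 < p)%N. Proof. exact: prime_gt0. Qed.
Let q0 : (0 < q)%N. Proof. by rewrite expn_gt0 p0. Qed.
Let h0 : (0 < h)%N. Proof. by rewrite expn_gt0 p0. Qed.
Let M10 : (0 < M1)%N. Proof. by case: M1 pM1 => //; rewrite dvdn0. Qed.
Let M0 : (0 < M)%N. Proof. by rewrite muln_gt0 q0. Qed.
Let qM : (q %| M)%N. Proof. by rewrite dvdn_mulr. Qed.
Let coM1 : coprime q M1. Proof. by rewrite /q coprime_pexpl // prime_coprime. Qed.

(** With [d] the order of [x], every [w * x] is a primitive [q * d]-th root of unity, and [A] or [B]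
    vanishes at all of these. For [x = 1] the assumption on [A] decides, so the second alternative
    can carry [x != 1], which [classsum0] requires. *)
Let dichotomy (x : algC) : x ^+ M1 = 1 ->
  (forall g, evc A q (g + h) x = evc A q g x) \/
  x != 1 /\ (forall g, evc B q (g + h) x = evc B q g x).
Proof.
move=> xM1; have [->|x1] := eqVneq x 1; first by left=> g; exact: Phi_evc_shift.
have [d px dM1] := prim_order_exists M10 xM1.
have cod : coprime q d by exact: coprime_dvdr dM1 coM1.
have d0 := prim_order_gt0 px.
have qd0 : (0 < q * d)%N by rewrite muln_gt0 q0.
have : Phi_dvd (q * d) (seq_mask A) || Phi_dvd (q * d) (seq_mask B).
  apply: (tiling_Phi M0 tAB); first by rewrite dvdn_pmul2l.
  by rewrite qE -mulnA muln_eq1 negb_and neq_ltn prime_gt1 ?orbT.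
by case/orP => /(Phi_dvdP _ qd0) Z; [left|right; split=> //]; apply: evc_shift => // w pw;
  apply: Z; exact: prim_root_mul.
Qed.

(** Translation by [q] preserves the class and multiplies the sum by [x ^+ q], which is not [1]
    because the order of [x] is prime to [q]. *)
Let classsum0 c (x : algC) : x ^+ M1 = 1 -> x != 1 ->
  \sum_(z < M | (z == c %[mod q])%N) x ^+ z = 0.
Proof.
move=> xM1 x1; have [d px dM1] := prim_order_exists M10 xM1.
have xM : x ^+ M = 1 by rewrite /M mulnC exprM xM1 expr1n.
have xq : x ^+ q - 1 != 0.
  rewrite subr_eq0 -(prim_order_dvd px); apply: contra x1 => dq.
  have : (d %| 1)%N by rewrite -(eqP coM1) dvdn_gcd dq.
  by rewrite (prim_order_dvd px) expr1.
apply: (mulfI xq); rewrite mulr0 mulrBl mul1r; apply/eqP; rewrite subr_eq0; apply/eqP.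
rewrite big_mkcond -[RHS](sum_shift (F := fun z => if (z == c %[mod q])%N then x ^+ z else 0) q).
  rewrite mulr_sumr; apply: eq_bigr => z _; rewrite modnDr.
  by case: ifP => _; rewrite ?mulr0 // exprD mulrC.
by move=> z; rewrite -modnDmr (eqP qM) addn0 exprD xM mulr1.
Qed.

Variables (al be : nat -> nat) (H : nat).
Hypotheses (dAB : decomposition M A B al be).
Hypotheses (dH : (h * M1 %| H)%N) (Hq : (H = h %[mod q])%N).

Lemma parity_class_sum c (x : algC) : x ^+ M1 = 1 ->
  exists2 y, y \in Aint &
    \sum_(z < M | parity p n al H z && (z == c %[mod q])%N) x ^+ z = p%:R * y.
Proof.
move=> xM1; case: (dichotomy xM1) => [inv|[x1 inv]].
  exact: (parity_sum p_pr n0 pM1 tAB dAB).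
have [y yA E] := parity_sum p_pr n0 pM1 (seq_tilingC tAB) (decompositionC dAB) dH Hq xM1 inv c.
exists (- y); first by rewrite rpredN.
rewrite mulrN -E; apply/eqP; rewrite -addr_eq0; apply/eqP.
rewrite -[RHS](classsum0 c xM1 x1) [RHS](bigID (fun z : 'I_M => parity p n al H z)) /=.
congr (_ + _).
  by apply: eq_bigl => z; rewrite andbC.
by apply: eq_bigl => z; rewrite andbC (parityN p_pr n0 pM1 tAB dAB).
Qed.

Lemma uniform_splitting z : be z = be (z + H) %[mod q]%N.
Proof.
apply/eqP; rewrite -(parityN p_pr n0 pM1 tAB dAB dH Hq).
apply/negP; rewrite -(parity_mod H tAB dAB) => wz.
set c := (z %% M)%N in wz; have cM : (c < M)%N by rewrite ltn_mod.
have [e pe] := C_prim_root_exists M10.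
(* Fourier inversion at [c] keeps only the [z] congruent to [c] both modulo [q] and modulo [M1],
   that is [c] itself; so [M1 / p] is an algebraic integer. *)
have [Y YA YE] : exists2 Y, Y \in Aint & M1%:R = p%:R * Y.
  have /fin_all_exists2 [y yA yE] : forall i : 'I_M1, exists2 y, y \in Aint &
     \sum_(z < M | parity p n al H z && (z == c %[mod q])%N) (e ^+ i) ^+ z = p%:R * y.
    by move=> i; apply: parity_class_sum; rewrite -exprM mulnC exprM (prim_expr_order pe) expr1n.
  exists (\sum_(i < M1) e ^+ (i * (M1.-1 * c)) * y i).
    by apply: rpred_sum => i _; rewrite rpredM ?rpredX // (Aint_prim_root pe).
  rewrite mulr_sumr.
  transitivity (\sum_(i < M1) e ^+ (i * (M1.-1 * c)) *
     \sum_(z < M | parity p n al H z && (z == c %[mod q])%N) (e ^+ i) ^+ z); last first.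
    by apply: eq_bigr => i _; rewrite yE; ring.
  under [RHS]eq_bigr do rewrite mulr_sumr.
  rewrite exchange_big /= (bigD1 (Ordinal cM)) ?wz ?eqxx //=.
  have inner (t : nat) : \sum_(i < M1) e ^+ (i * (M1.-1 * c)) * e ^+ i ^+ t =
      if (t == c %[mod M1])%N then M1%:R else 0.
    rewrite -[(t == c %[mod M1])%N](eqn_modDr (M1.-1 * c)) -mulSn prednK // modnMr -/(dvdn _ _).
    rewrite -(sum_prim_root _ pe); apply: eq_bigr => i _.
    by rewrite -exprM -exprD mulnDr addnC.
  rewrite inner eqxx big1 ?addr0 // => t /andP [/andP [_ tq] tc].
  rewrite inner; case: ifP => // tM; case/eqP: tc; apply: val_inj => /=.
  have := chinese_remainder coM1 t c; rewrite tq tM /= -/M.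
  by rewrite !modn_small // => /eqP.
have p0' : p%:R != 0 :> algC by rewrite Num.Theory.pnatr_eq0 -lt0n.
(* A rational algebraic integer is an integer, against [p] not dividing [M1]. *)
have : Y \is a Num.int.
  apply: Cint_rat_Aint => //.
  have -> : Y = M1%:R / p%:R by rewrite YE mulrC mulKf.
  by rewrite rpred_div ?rpred_nat.
case/Num.Theory.intrP => m mE; move: YE; rewrite mE => E; case/negP: pM1.
have : M1%:Z = p%:Z * m by apply: (@intr_inj algC); rewrite intrM.
by move=> /(congr1 absz); rewrite abszM /= => ->; rewrite dvdn_mulr.
Qed.

End Uniform.

(** Modulo [q], [be z] depends only on [z] modulo [h * M1]. Equal sums modulo [h * M1] therefore
    give [b = b'] modulo [q], then [a = a'] modulo [h]; the prescribed digit lifts this to [q], and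
    the sums agree modulo [M]. Sums being distinct, a count of sizes concludes. *)
Lemma slab_tiling p n M1 A B J : prime p -> (0 < n)%N -> ~~ (p %| M1)%N ->
  seq_tiling (p ^ n * M1) A B -> Phi_dvd (p ^ n) (seq_mask A) -> (forall r, J r < p)%N ->
  seq_tiling (p ^ n.-1 * M1) (slab p n J A) B.
Proof.
move=> p_pr n0 pM1 tAB PhiA Jp.
set q := (p ^ n)%N in tAB PhiA *; set h := (p ^ n.-1)%N; set M := (q * M1)%N in tAB.
have qE : q = (p * h)%N by rewrite /q /h -expnS prednK.
have h0 : (0 < h)%N by rewrite expn_gt0 prime_gt0.
have M10 : (0 < M1)%N by case: (M1) pM1 => //; rewrite dvdn0.
have hM10 : (0 < h * M1)%N by rewrite muln_gt0 h0.
have M0 : (0 < M)%N by rewrite /M qE -mulnA muln_gt0 prime_gt0.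
have qM : (q %| M)%N by rewrite dvdn_mulr.
have hq : (h %| q)%N by rewrite qE dvdn_mull.
have coM1 : coprime q M1 by rewrite /q coprime_pexpl // prime_coprime.
have [al [be dAB]] := tiling_decomp M0 tAB.
have [alA beB albe _] := dAB.
pose H := chinese q M1 h 0.
have Hq : (H = h %[mod q])%N by exact: chinese_modl.
have dH : (h * M1 %| H)%N.
  rewrite Gauss_dvd; last exact: coprime_dvdl hq coM1.
  rewrite /dvdn -(modn_dvdm _ hq) Hq modn_dvdm // modnn eqxx /=.
  by rewrite chinese_modr // mod0n.
have be_k z k : (be (z + k * H) = be z %[mod q])%N.
  elim: k => [|k IH]; first by rewrite mul0n addn0.
  rewrite -IH mulSn addnC -addnA [(_ + z)%N]addnC addnC.
  by rewrite (uniform_splitting p_pr n0 pM1 tAB PhiA dAB dH Hq (z + k * H)).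
have be_eq z z' : (z = z' %[mod h * M1])%N -> (be z = be z' %[mod q])%N.
  move=> E; have qz : (q.-1.+1 = q)%N by rewrite prednK // qE muln_gt0 prime_gt0.
  (* Modulo [q], [z' - z] is [k * h], so [k] steps of [H] lead from [z] to [z'] modulo [M]. *)
  have /dvdnP [k kE] : (h %| z' + q.-1 * z)%N.
    rewrite /dvdn -modnDml -(modn_dvdm z' (dvdn_mulr M1 (dvdnn h))) -E modn_dvdm ?dvdn_mulr //.
    by rewrite modnDml -mulSn qz; apply: dvdn_mulr.
  rewrite -(be_k z k) -(decomp_mod tAB dAB (z + k * H)).2 -[in RHS](decomp_mod tAB dAB z').2.
  suff -> : (z + k * H = z' %[mod q * M1])%N by [].
  apply/eqP; rewrite chinese_remainder //; apply/andP; split; apply/eqP.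
    rewrite -modnDmr -modnMmr Hq modnMmr -kE modnDmr addnCA -mulSn qz.
    by rewrite -modnDmr modnMr addn0.
  have /dvdnP [j ->] : (M1 %| H)%N by apply: dvdn_trans dH; rewrite dvdn_mull.
  rewrite mulnA addnC modnMDl.
  by rewrite -(modn_dvdm z (dvdn_mull h (dvdnn M1))) E modn_dvdm ?dvdn_mull.
have inj : {in pairs (slab p n J A) B &,
    injective (fun ab : nat * nat => (ab.1 + ab.2) %% (h * M1))%N}.
  move=> [a b] [a' b']; rewrite !mem_pairs !mem_filter => /andP [/andP [/eqP da aA] bB].
  move=> /andP [/andP [/eqP da' aA'] bB'] /= E.
  have [ea eb] : al (a + b)%N = a /\ be (a + b)%N = b by apply: (tiling_inj tAB).
  have [ea' eb'] : al (a' + b')%N = a' /\ be (a' + b')%N = b' by apply: (tiling_inj tAB).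
  have bq : (b = b' %[mod q])%N by rewrite -eb -eb'; exact: be_eq.
  have ah : (a = a' %[mod h])%N.
    apply/eqP; rewrite -(eqn_modDr b).
    have -> : (a' + b = a' + b' %[mod h])%N.
      by rewrite -modnDmr -(modn_dvdm b hq) bq modn_dvdm // modnDmr.
    have hh : (h %| h * M1)%N by rewrite dvdn_mulr.
    by rewrite -(modn_dvdm (a + b) hh) E modn_dvdm.
  have aq : (a = a' %[mod q])%N.
    by rewrite !(digit_mod p_pr n0) -/h da da' -/h ah.
  have : (a + b = a' + b' %[mod q * M1])%N.
    apply/eqP; rewrite chinese_remainder //; apply/andP; split; apply/eqP.
      by rewrite -modnDm aq bq modnDm.
    have hh : (M1 %| h * M1)%N by rewrite dvdn_mull.
    by rewrite -(modn_dvdm (a + b) hh) E modn_dvdm.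
  by case/(tiling_inj tAB) => // -> ->.
have uAB : uniq [seq ((ab.1 + ab.2) %% (h * M1))%N | ab <- pairs (slab p n J A) B].
  by rewrite map_inj_in_uniq // pairs_filter filter_uniq // (tiling_uniq tAB).
have sub : {subset [seq ((ab.1 + ab.2) %% (h * M1))%N | ab <- pairs (slab p n J A) B]
    <= iota 0 (h * M1)}.
  by move=> _ /mapP [ab _ ->]; rewrite mem_iota /= ltn_mod.
have sz : (size (slab p n J A) * size B = h * M1)%N.
  have := tiling_size tAB; rewrite (size_slab p_pr n0 (A := A) (J := J)) //; last first.
    by move=> g; apply: Phi_evc_shift.
  by rewrite /M qE -!mulnA => /eqP; rewrite eqn_pmul2l ?prime_gt0 // => /eqP.
apply: uniq_perm => //; first exact: iota_uniq.
by have [|_ E] := uniq_min_size uAB sub; rewrite // size_iota size_map size_allpairs sz.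
Qed.

(** * Cyclotomic factors of prime power order and cardinalities *)

Lemma count_class p h A g : (0 < p)%N -> (0 < h)%N ->
  count (fun a => a == g %[mod h])%N A =
  (\sum_(j < p) count (fun a => a == g + j * h %[mod p * h])%N A)%N.
Proof.
move=> p0 h0; rewrite -sum1_count big_mkcond /=.
under [RHS]eq_bigr do rewrite -sum1_count big_mkcond.
rewrite exchange_big; apply: eq_bigr => a _ /=.
case: ifP => [ag|nag]; last first.
  rewrite big1 // => j _; case: ifP => // E; move: nag.
  have hp : (h %| p * h)%N by rewrite dvdn_mull.
  by rewrite -(modn_dvdm a hp) (eqP E) modn_dvdm // addnC modnMDl eqxx.
have P0 : (0 < p * h)%N by rewrite muln_gt0 p0.
(* Modulo [p], [k] is [(a - g) / h], which selects the subclass containing [a]. *)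
have /dvdnP [k kE] : (h %| a + (p * h).-1 * g)%N.
  rewrite /dvdn -modnDml (eqP ag) modnDml -mulSn prednK //.
  by rewrite -/(dvdn _ _) -mulnA dvdn_mull // dvdn_mulr.
rewrite -[LHS](@sum_class _ 0%N addn p k _ p0); apply: eq_bigr => j _.
suff -> : (a == g + j * h %[mod p * h])%N = (k == j %[mod p])%N by [].
rewrite -(eqn_modDr ((p * h).-1 * g)) kE addnAC -mulSn prednK //.
by rewrite [(p * h * g)%N]mulnC modnMDl -!muln_modl // eqn_pmul2r.
Qed.

(** A class modulo [p ^ a] consists of [p] classes modulo [p ^ a.+1], equally large when the
    cyclotomic polynomial of order [p ^ a.+1] divides the mask; each such level contributes a factor
    [p]. *)
Lemma dvdn_size_Phi p A k a g : prime p ->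
  (p ^ (\sum_(i < k) Phi_dvd (p ^ (a + i).+1) (seq_mask A)) %|
     count (fun x => x == g %[mod p ^ a]) A)%N.
Proof.
move=> p_pr; have p0 := prime_gt0 p_pr.
elim: k a g => [|k IH] a g; first by rewrite big_ord0 dvd1n.
have h0 : (0 < p ^ a)%N by rewrite expn_gt0 p0.
rewrite big_ord_recl addn0 (count_class A g p0 h0) -expnS.
have {}IH j : (p ^ (\sum_(i < k) Phi_dvd (p ^ (a + bump 0 i).+1) (seq_mask A)) %|
     count (fun x => x == j %[mod p ^ a.+1]) A)%N.
  have -> : (\sum_(i < k) Phi_dvd (p ^ (a + bump 0 i).+1) (seq_mask A) =
    \sum_(i < k) Phi_dvd (p ^ (a.+1 + i).+1) (seq_mask A))%N; last exact: IH.
  by apply: eq_bigr => i _; rewrite /bump add1n addnS addSn.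
case: (boolP (Phi_dvd (p ^ a.+1) (seq_mask A))) => [PhiA|_]; last first.
  by rewrite add0n dvdn_sum.
have per j : count (fun x => x == g + j * p ^ a %[mod p ^ a.+1])%N A =
             count (fun x => x == g %[mod p ^ a.+1])%N A.
  have evcN j' : evc A (p ^ a.+1) j' 1 = (count (fun x => x == j' %[mod p ^ a.+1])%N A)%:R.
    by rewrite /evc -sum1_count natr_sum; apply: eq_bigr => x _; rewrite expr1n.
  apply/eqP; rewrite -(@Num.Theory.eqr_nat algC) -!evcN; apply/eqP.
  elim: j => [|j IHj]; first by rewrite addn0.
  by rewrite mulSn [(p ^ a + _)%N]addnC addnA (Phi_evc_shift (n := a.+1)).
under [X in (_ %| X)%N]eq_bigr do rewrite per.
by rewrite sum_nat_const card_ord expnD expn1 dvdn_pmul2l.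
Qed.

(* Coven--Meyerowitz: each prime power [p ^ i] dividing [N] is in [S_A] or [S_B], while the
   powers of [p] in [S_A] and [S_B] together contribute at most [logn p N] factors [p] to
   [|A| |B| = N]. *)
Lemma Phi_prime_power_excl N A B p a : (0 < N)%N -> seq_tiling N A B -> prime p -> (0 < a)%N ->
  Phi_dvd (p ^ a) (seq_mask A) -> (p ^ a %| N)%N /\ ~~ Phi_dvd (p ^ a) (seq_mask B).
Proof.
move=> N0 tAB p_pr; case: a => // a _ PA; set n := logn p N.
rewrite pfactor_dvdn // -/n; apply/andP; apply: contraT; rewrite negb_and negbK => bad.
pose f C i := Phi_dvd (p ^ i.+1) (seq_mask C) : nat.
have dv C : (p ^ (\sum_(i < n + a.+1) f C i) %| size C)%N.
  have := @dvdn_size_Phi p C (n + a.+1) 0 0 p_pr.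
  have -> : count (fun x => x == 0 %[mod p ^ 0])%N C = size C.
    by rewrite (eq_count (a2 := predT)) ?count_predT // => x; rewrite !modn1.
  by [].
have : (p ^ (\sum_(i < n + a.+1) (f A i + f B i)) %| N)%N.
  by rewrite big_split expnD -(tiling_size tAB) dvdn_mul.
rewrite pfactor_dvdn // -/n leqNgt => /negP [].
(* Every [i < n] counts at least once, and [a] once more: either [a < n] and both masks have the
   factor, or [a] lies outside that range. The total exceeds [n]. *)
have lb (i : 'I_(n + a.+1)) : ((i < n) + (i == a :> nat) <= f A i + f B i)%N.
  have [-> | ia] := eqVneq (i : nat) a.
    rewrite /f PA; move: bad; case: (a < n)%N => //= ->; by [].
  rewrite addn0; case: ltnP => // iN.
  have : Phi_dvd (p ^ i.+1) (seq_mask A) || Phi_dvd (p ^ i.+1) (seq_mask B).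
    apply: (tiling_Phi N0 tAB); first by rewrite pfactor_dvdn.
    by rewrite neq_ltn prime_power_gt1 ?orbT.
  by rewrite /f; case: Phi_dvd => //= ->.
apply: leq_trans (leq_sum _ (fun i _ => lb i)); rewrite big_split /=.
rewrite -addn1 leq_add //.
  rewrite big_split_ord /= (eq_bigr (fun=> 1%N)) => [|i _]; last by rewrite ltn_ord.
  by rewrite sum1_card card_ord leq_addr.
have an : (a < n + a.+1)%N by rewrite addnS ltnS leq_addl.
by rewrite (bigD1 (Ordinal an)) //= eqxx.
Qed.

(** * The condition (T2) *)

Definition seq_T2 (A : seq nat) : Prop :=
  forall s : seq (nat * nat),
    s != [::] ->
    uniq (map fst s) ->
    all (fun pa => [&& prime pa.1, (0 < pa.2)%N & Phi_dvd (pa.1 ^ pa.2) (seq_mask A)]) s ->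
    Phi_dvd (\prod_(pa <- s) pa.1 ^ pa.2)%N (seq_mask A).

(** [r ^ a] divides the period and [B] lacks this factor, by [Phi_prime_power_excl]. Being different
    from [p ^ n], [r ^ a] still divides the lowered period, so the slab must have the factor. *)
Lemma slab_Phi p n M1 A B J r a : prime p -> (0 < n)%N -> ~~ (p %| M1)%N ->
  seq_tiling (p ^ n * M1) A B -> Phi_dvd (p ^ n) (seq_mask A) -> (forall i, J i < p)%N ->
  prime r -> (0 < a)%N -> Phi_dvd (r ^ a) (seq_mask A) -> (r, a) != (p, n) ->
  Phi_dvd (r ^ a) (seq_mask (slab p n J A)).
Proof.
move=> p_pr n0 pM1 tAB PhiA Jp r_pr a0 Pr ne.
have M10 : (0 < M1)%N by case: (M1) pM1 => //; rewrite dvdn0.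
have N0 k : (0 < p ^ k * M1)%N by rewrite muln_gt0 expn_gt0 prime_gt0.
have [rM rB] := Phi_prime_power_excl (N0 n) tAB r_pr a0 Pr.
have tJ := slab_tiling p_pr n0 pM1 tAB PhiA Jp.
suff rd : (r ^ a %| p ^ n.-1 * M1)%N.
  have := tiling_Phi (N0 _) tJ rd; rewrite (negbTE rB) orbF; apply.
  by rewrite neq_ltn prime_power_gt1 ?orbT.
have [rp|rp] := eqVneq r p.
  rewrite rp in ne rM *.
  have : (p ^ a %| p ^ n)%N by rewrite -(@Gauss_dvdl _ _ M1) // coprime_pexpl // prime_coprime.
  rewrite dvdn_Pexp2l ?prime_gt1 // => an; apply/dvdn_mulr/dvdn_exp2l.
  by move: ne; rewrite xpair_eqE eqxx /= => ne; lia.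
apply: dvdn_mull; rewrite -(@Gauss_dvdr _ (p ^ n)) //.
by rewrite coprime_pexpl // coprime_pexpr // prime_coprime // dvdn_prime2.
Qed.

Lemma seq_T2_step p n M1 A B : prime p -> (0 < n)%N -> ~~ (p %| M1)%N ->
  (forall A' B', seq_tiling (p ^ n.-1 * M1) A' B' -> seq_T2 A' /\ seq_T2 B') ->
  seq_tiling (p ^ n * M1) A B -> Phi_dvd (p ^ n) (seq_mask A) -> seq_T2 A /\ seq_T2 B.
Proof.
move=> p_pr n0 pM1 IH tAB PhiA; have p0 := prime_gt0 p_pr.
have q0 : (0 < p ^ n)%N by rewrite expn_gt0 p0.
have tJ J := slab_tiling (J := J) p_pr n0 pM1 tAB PhiA.
(* [B] is also a factor of the smaller tiling, with the slab of digit [0]. *)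
split; last by have [|_] := IH _ _ (tJ (fun=> 0%N) _).
have SJ (s : seq (nat * nat)) J : (p, n) \notin s -> (forall i, J i < p)%N -> s != [::] ->
  uniq (map fst s) ->
  all (fun pa => [&& prime pa.1, (0 < pa.2)%N & Phi_dvd (pa.1 ^ pa.2) (seq_mask A)]) s ->
  Phi_dvd (\prod_(pa <- s) pa.1 ^ pa.2)%N (seq_mask (slab p n J A)).
  move=> pns Jp s0 us /allP Ss; apply: (proj1 (IH _ _ (tJ J Jp))) => //.
  apply/allP => -[r a] ras; have /and3P [/= r_pr a0 Pr] := Ss _ ras.
  rewrite r_pr a0 /=; apply: (slab_Phi p_pr n0 pM1 tAB) => //.
  by apply: contra pns => /eqP <-.
have prod_gt0 (s : seq (nat * nat)) :
  all (fun pa => [&& prime pa.1, (0 < pa.2)%N & Phi_dvd (pa.1 ^ pa.2) (seq_mask A)]) s ->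
  (0 < \prod_(pa <- s) pa.1 ^ pa.2)%N.
  move=> /allP Ss; rewrite big_seq; apply: prodn_cond_gt0 => pa /Ss /and3P [r_pr _ _].
  by rewrite expn_gt0 prime_gt0.
move=> s s0 us Ss; have [pns|pns] := boolP ((p, n) \in s); last first.
  (* [A] is the disjoint union of the [p] slabs of constant digit, each of which vanishes at [z]. *)
  apply/(Phi_dvdP _ (prod_gt0 _ Ss)) => z pz; rewrite (ev_slabs n p_pr) big1 // => j _.
  by apply: (elimT (Phi_dvdP _ (prod_gt0 _ Ss))) pz; apply: SJ.
have ps := perm_to_rem pns; rewrite (perm_big _ ps) big_cons /=.
move: us Ss; rewrite (perm_uniq (perm_map fst ps)) (perm_all _ ps) /=.
set t := rem _ s => /andP [pt ut] /andP [_ St].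
have [->|t0] := eqVneq t [::]; first by rewrite big_nil muln1.
have pnt : (p, n) \notin t by apply: contra pt => /(map_f fst).
set d := (\prod_(pa <- t) _)%N; have d0 : (0 < d)%N := prod_gt0 _ St.
have cod : coprime (p ^ n) d.
  rewrite /d big_seq; apply: (big_ind (fun m => coprime (p ^ n) m)) => [|x y cx cy|[r a] ra].
  - exact: coprimen1.
  - by rewrite coprimeMr cx.
  have /and3P [/= r_pr a0 _] := allP St _ ra.
  rewrite coprime_pexpl // coprime_pexpr // prime_coprime // dvdn_prime2 //.
  by apply: contra pt => /eqP ->; exact: (map_f fst ra).
have [w pw] := C_prim_root_exists q0; have [x px] := C_prim_root_exists d0.
rewrite (Phi_dvdE _ (prim_root_mul pw px cod)); apply/eqP.
(* All slabs vanish at [x], so the class sums of [A] at [x] are periodic, which makes [w * x] a zero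
   of [A]. *)
apply: (ev_shift p_pr n0) pw => g; apply: (slab_evc p_pr n0) => J Jp.
by apply: (elimT (Phi_dvdP _ d0)) px; apply: SJ.
Qed.

Theorem seq_tiling_T2 N A B : (0 < N)%N -> seq_tiling N A B -> seq_T2 A /\ seq_T2 B.
Proof.
elim/ltn_ind: N A B => N IH A B N0 tAB.
(* For period [1], (T2) is vacuous: the prime powers in S_A divide the period. *)
have [N1|N1] := leqP N 1.
  have S0 C D : seq_tiling N C D -> seq_T2 C.
    move=> tCD [|[r a] s] //= _ _ /andP [/and3P [/= r_pr a0 Pr] _].
    have [] := Phi_prime_power_excl N0 tCD r_pr a0 Pr.
    have -> : N = 1%N by lia.
    by rewrite gtnNdvd ?prime_power_gt1.
  by split; [apply: S0 tAB|apply: S0 (seq_tilingC tAB)].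
pose p := pdiv N; have p_pr : prime p by exact: pdiv_prime.
have n0 : (0 < logn p N)%N by rewrite logn_gt0 mem_primes p_pr N0 pdiv_dvd.
have [M1 co NE] := pfactor_coprime p_pr N0.
set n := logn p N in n0 NE; rewrite mulnC in NE.
have pM1 : ~~ (p %| M1)%N by rewrite -prime_coprime.
have IHp A' B' : seq_tiling (p ^ n.-1 * M1) A' B' -> seq_T2 A' /\ seq_T2 B'.
  have N'0 : (0 < p ^ n.-1 * M1)%N.
    by move: N0; rewrite NE !muln_gt0 !expn_gt0 prime_gt0.
  apply: IH => //; rewrite [X in (_ < X)%N]NE -{2}(prednK n0) expnS -mulnA.
  by rewrite ltn_Pmull // prime_gt1.
have tAB' := tAB; rewrite NE in tAB'.
have : Phi_dvd (p ^ n) (seq_mask A) || Phi_dvd (p ^ n) (seq_mask B).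
  apply: (tiling_Phi N0 tAB); first by rewrite NE dvdn_mulr.
  by rewrite neq_ltn prime_power_gt1 ?orbT.
case/orP => [PA|PB]; first exact: seq_T2_step tAB' PA.
by have [] := seq_T2_step p_pr n0 pM1 IHp (seq_tilingC tAB') PB.
Qed.

(** * From lists of integers back to subsets of Z_N *)

Definition set_seq N (A : {set 'I_N}) : seq nat := [seq val a | a <- enum A].

Lemma mask_set_seq N (A : {set 'I_N}) : Defs.mask A = seq_mask (set_seq A).
Proof. by rewrite /Defs.mask /seq_mask /set_seq big_map big_enum. Qed.

Lemma tiling_set_seq N (A B : {set 'I_N}) : tiling A B -> seq_tiling N (set_seq A) (set_seq B).
Proof.
move=> tAB; apply/allP => x xL /=; have xN : (x < N)%N.
  move: xL; rewrite mem_cat mem_iota /= => /orP [/mapP [[a b]]|//].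
  rewrite mem_pairs => /andP [/mapP [y _ _] _] ->; rewrite ltn_mod.
  exact: leq_ltn_trans (ltn_ord y).
apply/eqP; rewrite (count_uniq_mem _ (iota_uniq _ _)) mem_iota xN.
rewrite -[RHS](tAB (Ordinal xN)) -sum1_card -sum1_count big_map big_mkcond.
rewrite big_allpairs /= big_map big_enum /=.
under eq_bigr => a _ do rewrite big_map -big_mkcond big_enum_cond /=.
rewrite pair_big_dep /=; apply: eq_bigl => -[a b]; rewrite !inE /=.
by rewrite andbA.
Qed.

Theorem theorem1p2 (p1 n1 M1 : nat) :
  prime p1 ->
  ~~ (p1 %| M1)%N ->
  (forall M' : nat, (M' %| M1)%N ->
     forall A' B' : {set 'I_M'}, tiling A' B' -> T2 A' /\ T2 B') ->
  (Dfun M1 < p1)%N ->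
  forall A B : {set 'I_(p1 ^ n1 * M1)}, tiling A B -> T2 A /\ T2 B.
Proof.
move=> p_pr pM1 _ _ A B /tiling_set_seq tAB.
have N0 : (0 < p1 ^ n1 * M1)%N.
  by rewrite muln_gt0 expn_gt0 prime_gt0 //=; case: (M1) pM1 => //; rewrite dvdn0.
have T2E (C : {set 'I_(p1 ^ n1 * M1)}) : seq_T2 (set_seq C) -> T2 C.
  by move=> TC s s0 us Ss; rewrite mask_set_seq; apply: TC => //; rewrite -mask_set_seq.
by have [TA TB] := seq_tiling_T2 N0 tAB; split; apply: T2E.
Qed.
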